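(* Let $\mathcal{T}$ be the family of Poncelet triangles inscribed in the ellipse $\mathcal{E}: x^2/a^2+y^2/b^2=1$ and circumscribing the nested ellipse $\mathcal{E}_c$ with center $O_c=[x_c,y_c]$. Let $f,g\in\mathbb{C}$ be the foci of the image of $\mathcal{E}_c$ under the affine map $(x,y)\mapsto x/a+i\,y/b$. Then, over $\mathcal{T}$, the locus of the orthocenter $X_4$ is an ellipse homothetic to a $90^\circ$-rotated copy of $\mathcal{E}$. Its center $C_4$ depends only on $a,b$ and $O_c$ and is given by $$C_4=(a^2+b^2)\left[\frac{x_c}{a^2},\ \frac{y_c}{b^2}\right].$$ Its semiaxes $a_4\ge b_4$ (the former parallel to the minor axis of $\mathcal{E}$) are given by $$a_4=\frac{\sigma}{2b},\qquad b_4=\frac{\sigma}{2a},\qquad \sigma=\left|fg\,(a^2+b^2)-c^2\right|\ge 0,$$ where $c^2=a^2-b^2$. In particular $a_4/b_4=a/b$ (when $\sigma>0$).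
   Context: $\mathcal{E}$ is the ellipse centered at the origin with semiaxes $a\ge b>0$ along the $x$ and $y$ directions. $\mathcal{E}_c$ is an ellipse contained in the interior of $\mathcal{E}$ such that some triangle is inscribed in $\mathcal{E}$ (vertices on $\mathcal{E}$) and circumscribes $\mathcal{E}_c$ (its three sides are tangent to $\mathcal{E}_c$); by Poncelet's porism every point of $\mathcal{E}$ is then a vertex of such a triangle. $\mathcal{T}$ denotes the one-parameter family of all such triangles. The locus of $X_4$ is the set of orthocenters of the triangles in $\mathcal{T}$. $\mathbb{R}^2$ is identified with $\mathbb{C}$, and $fg$ is a product of complex numbers. The value $\sigma=0$ is allowed, in which case the ellipse is degenerate (the single point $C_4$). *)

(* Defs.v *)
(* The plane R^2 is identified with R[i]: (x, y) is x +i* y. *)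
From HB Require Import structures.
From mathcomp Require Import all_boot all_order all_algebra.
From mathcomp Require Import all_classical all_reals.
From mathcomp Require Export complex.
Set Implicit Arguments.
Unset Strict Implicit.
Unset Printing Implicit Defensive.
Import Order.TTheory GRing.Theory Num.Theory.
Local Open Scope classical_set_scope.
Local Open Scope ring_scope.
Local Open Scope complex_scope.

(* Euclidean modulus, valued in R (the norm [`|z|] of R[i] is valued in R[i]). *)
Definition modulus (R : realType) (z : R[i]) : R := ComplexField.Normc.normc z.

Definition dot (R : realType) (z w : R[i]) : R :=
  complex.Re z * complex.Re w + complex.Im z * complex.Im w.

(* Ellipse with center O, semiaxis p along the unit vector u and semiaxis q
   along 'i * u.  The parametric form makes sense for p = q = 0 as well, where
   it is the single point O. *)
Definition ellipse_curve (R : realType) (O u : R[i]) (p q : R) : set R[i] :=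
  [set z | exists s t : R,
     s ^+ 2 + t ^+ 2 = 1 /\ z = O + u * ((p * s) +i* (q * t))].

Definition is_ellipse (R : realType) (S : set R[i]) (O u : R[i]) (p q : R)
    : Prop :=
  [/\ modulus u = 1, 0 < q, q <= p & S = ellipse_curve O u p q].

(* The pair (f, g) is considered up to order, as u may be replaced by - u;
   f = g when S is a circle. *)
Definition foci (R : realType) (S : set R[i]) (f g : R[i]) : Prop :=
  exists (O u : R[i]) (p q : R),
    [/\ is_ellipse S O u p q,
        f = O + (Num.sqrt (p ^+ 2 - q ^+ 2))%:C * u &
        g = O - (Num.sqrt (p ^+ 2 - q ^+ 2))%:C * u].

Definition outer_ellipse (R : realType) (a b : R) : set R[i] :=
  [set z | complex.Re z ^+ 2 / a ^+ 2 + complex.Im z ^+ 2 / b ^+ 2 = 1].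

(* The bounded region enclosed by the curve, not its topological interior. *)
Definition outer_ellipse_inside (R : realType) (a b : R) : set R[i] :=
  [set z | complex.Re z ^+ 2 / a ^+ 2 + complex.Im z ^+ 2 / b ^+ 2 < 1].

Definition unit_disk_map (R : realType) (a b : R) (z : R[i]) : R[i] :=
  (complex.Re z / a) +i* (complex.Im z / b).

Definition line (R : realType) (P Q : R[i]) : set R[i] :=
  [set z | exists t : R, z = P + t%:C * (Q - P)].

(* Only used for S an ellipse, where a line is tangent exactly when it meets
   the curve in one point. *)
Definition tangent (R : realType) (L S : set R[i]) : Prop :=
  exists! z, (L `&` S) z.

Definition noncollinear (R : realType) (A B C : R[i]) : Prop :=
  A <> B /\ ~ line A B C.

Definition poncelet_triangle (R : realType) (a b : R) (Ec : set R[i])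
    (A B C : R[i]) : Prop :=
  [/\ noncollinear A B C,
      [/\ outer_ellipse a b A, outer_ellipse a b B & outer_ellipse a b C] &
      [/\ tangent (line A B) Ec, tangent (line B C) Ec &
          tangent (line C A) Ec]].

Definition orthocenter (R : realType) (A B C H : R[i]) : Prop :=
  [/\ dot (H - A) (B - C) = 0, dot (H - B) (C - A) = 0 &
      dot (H - C) (A - B) = 0].

Definition X4_locus (R : realType) (a b : R) (Ec : set R[i]) : set R[i] :=
  [set H | exists A B C : R[i],
     poncelet_triangle a b Ec A B C /\ orthocenter A B C H].

(* S' is the image of S under a dilation of positive ratio followed by a
   translation. *)
Definition homothetic (R : realType) (S S' : set R[i]) : Prop :=
  exists (k : R) (w : R[i]), 0 < k /\ S' = [set w + k%:C * z | z in S].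

Definition rotate90 (R : realType) (S : set R[i]) : set R[i] :=
  [set 'i * z | z in S].

(* Main.v *)
Require Import Defs.
From HB Require Import structures.
From mathcomp Require Import all_boot all_order all_algebra.
From mathcomp Require Import all_classical all_reals.
From mathcomp Require Import complex ring lra.
Set Implicit Arguments.
Unset Strict Implicit.
Unset Printing Implicit Defensive.
Import Order.TTheory GRing.Theory Num.Theory.
Local Open Scope classical_set_scope.
Local Open Scope ring_scope.
Local Open Scope complex_scope.

(** The map (x, y) |-> x/a + i y/b turns the outer ellipse into the unit circle
    and the inner one into an ellipse with foci f, g and some semiminor axis q.
    Lines and tangency are preserved, so the triangles become those inscribed in
    the unit circle and circumscribing that ellipse.

    A line is tangent to an ellipse exactly when the product of its signed
    distances to the foci is the squared semiminor axis ([tangent_ellipse]).  For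
    the chord of the unit circle through z and w, where conjugation is inversion,
    this reads (f + z w f^* - z - w) (g + z w g^* - z - w) = 4 q^2 z w
    ([chord_tangency]).  For fixed z it is quadratic in w, and its roots are the
    two other vertices.  Vieta gives their product, so every vertex is a root of
    z (z - f) (z - g) = l (1 - f^* z) (1 - g^* z) with l the product of the three
    vertices, and hence z1 + z2 + z3 = f + g + l f^* g^*.  Comparing
    this with Vieta's formula for the sum of two vertices gives
    4 q^2 = (1 - |f|^2) (1 - |g|^2) ([tangency_triangle]): this is all that
    the existence of one triangle says about the inner ellipse.

    Conversely, for each l with |l| = 1 the roots of the cubic, which is a degree
    three Blaschke product set equal to l, lie on the circle because
    |f|, |g| < 1, are distinct, and form a Poncelet triangle
    ([blaschke_triangle]).  So the family is parametrized by l in the unit circle.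

    Finally the orthocenter of the triangle in the original plane depends only
    on the sum and the product of z1, z2, z3 and is real-linear in them
    ([inscribed_altitude]).  Substituting the sum gives the point
    C4 + Re v / (2 a) + i Im v / (2 b) with v = k^* l and
    k = f g (a^2 + b^2) - c^2 ([inscribed_orthocenter_blaschke]).  When l runs over
    the unit circle, v runs over the circle of radius sigma = |k|, which gives
    the ellipse.  The center uses f + g = 2 (xc/a + i yc/b): an ellipse has only
    one center of symmetry ([ellipse_curve_center_unique]). *)

(* [^*] otherwise denotes [conjc] in [complex_scope] but [Num.conj] in
   [ring_scope], where the operands of ring operations are parsed. *)
Local Notation "x ^*" := (conjc x) : ring_scope.

(** * Algebra of the tangency relation *)

(** Reduces an equation to a ring identity once a combination [u = v] of known
    equations that implies it has been chosen. *)
Lemma eq_of_sub_eq (V : zmodType) (x y u v : V) :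
  u = v -> x - y = u - v -> x = y.
Proof. by move=> -> /eqP; rewrite subrr subr_eq0 => /eqP. Qed.

Ltac combine1 F E := apply: (eq_of_sub_eq (congr1 F E)); rewrite /=; ring.
Ltac combine2 F E E' := apply: (eq_of_sub_eq (congr2 F E E')); rewrite /=; ring.

(** On the unit circle, [tangency f g f^* g^* (4 * q ^+ 2) z w = 0] says that the
    chord through z and w touches the ellipse with foci f, g and semiminor axis
    q.  The conjugates [fb], [gb] of [f], [g] are independent variables here, as
    only field identities are involved. *)
Definition tangency (K : fieldType) (f g fb gb k z w : K) : K :=
  (f + z * w * fb - z - w) * (g + z * w * gb - z - w) - k * (z * w).

(** Its roots on the unit circle are the points where the Blaschke product with
    zeros 0, f, g takes the value l. *)
Definition blaschke_cubic (K : fieldType) (f g fb gb l z : K) : K :=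
  z * (z - f) * (z - g) - l * (1 - z * fb) * (1 - z * gb).

Lemma sum_roots_cubic (K : fieldType) (e1 e2 l z1 z2 z3 : K) :
  z1 != z2 -> z1 != z3 -> z2 != z3 ->
  (forall z, z \in [:: z1; z2; z3] -> z ^+ 3 - e1 * z ^+ 2 + e2 * z = l) ->
  z1 + z2 + z3 = e1.
Proof.
move=> h12 h13 h23 h.
have [E1 E2 E3] : [/\ z1 ^+ 3 - e1 * z1 ^+ 2 + e2 * z1 = l,
  z2 ^+ 3 - e1 * z2 ^+ 2 + e2 * z2 = l & z3 ^+ 3 - e1 * z3 ^+ 2 + e2 * z3 = l].
  by split; apply: h; rewrite !inE eqxx ?orbT.
have D12 : z1 ^+ 2 + z1 * z2 + z2 ^+ 2 - e1 * (z1 + z2) + e2 = 0.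
  by apply: (@mulfI _ (z1 - z2)); [rewrite subr_eq0 |
    combine2 (fun x y : K => x - y) E1 E2].
have D13 : z1 ^+ 2 + z1 * z3 + z3 ^+ 2 - e1 * (z1 + z3) + e2 = 0.
  by apply: (@mulfI _ (z1 - z3)); [rewrite subr_eq0 |
    combine2 (fun x y : K => x - y) E1 E3].
by apply: (@mulfI _ (z2 - z3)); [rewrite subr_eq0 |
    combine2 (fun x y : K => x - y) D12 D13].
Qed.

(** As a polynomial in w, [tangency f g fb gb k z w] has leading coefficient
    (1 - z fb) (1 - z gb) and constant term (f - z) (g - z).  Vieta's formulas for
    the product and the sum of its two roots are the two conclusions. *)
Lemma cubic_of_tangency (K : fieldType) (f g fb gb k z z' z'' : K) :
  z' != z'' ->
  tangency f g fb gb k z z' = 0 -> tangency f g fb gb k z z'' = 0 ->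
  blaschke_cubic f g fb gb (z * z' * z'') z = 0 /\
  (1 - z * fb) * (1 - z * gb) * (z' + z'')
    = (f - z) * (1 - z * gb) + (g - z) * (1 - z * fb) + k * z.
Proof.
rewrite /tangency /blaschke_cubic => h E1 E2.
have S : (1 - z * fb) * (1 - z * gb) * (z' + z'')
    = (f - z) * (1 - z * gb) + (g - z) * (1 - z * fb) + k * z.
  by apply: (@mulfI _ (z' - z'')); [rewrite subr_eq0 |
    combine2 (fun x y : K => x - y) E1 E2].
split=> //; combine2 (fun x y : K => z * (x - z' * y)) E1 S.
Qed.

(** All three vertices are roots of one cubic, whose second coefficient gives the
    sum.  Subtracting z1 gives z2 + z3 without reference to k, and comparing with
    Vieta's formula for z2 + z3 determines k. *)
Lemma tangency_triangle (K : fieldType) (f g fb gb k z1 z2 z3 : K) :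
  z1 != 0 -> z1 != z2 -> z1 != z3 -> z2 != z3 ->
  tangency f g fb gb k z1 z2 = 0 -> tangency f g fb gb k z2 z3 = 0 ->
  tangency f g fb gb k z3 z1 = 0 ->
  z1 + z2 + z3 = f + g + z1 * z2 * z3 * (fb * gb) /\
  k = (1 - f * fb) * (1 - g * gb).
Proof.
move=> z0 h12 h13 h23 T12 T23 T31.
have sym z w : tangency f g fb gb k z w = tangency f g fb gb k w z.
  by rewrite /tangency; ring.
have [C1 S1] := cubic_of_tangency h23 T12 (etrans (sym _ _) T31).
have [C2 _] := cubic_of_tangency h13 (etrans (sym _ _) T12) T23.
have [C3 _] := cubic_of_tangency h12 T31 (etrans (sym _ _) T23).
have S : z1 + z2 + z3 = f + g + z1 * z2 * z3 * (fb * gb).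
  apply: (@sum_roots_cubic _ _ (f * g + z1 * z2 * z3 * (fb + gb)) (z1 * z2 * z3))
    => // z.
  rewrite !inE /blaschke_cubic in C1 C2 C3 *.
  case/or3P => /eqP ->; [move: C1 | move: C2 | move: C3] => C0;
    combine1 (fun x : K => x) C0.
split=> //.
apply: (mulfI z0); rewrite /blaschke_cubic in C1.
have S' : z2 + z3 = f + g + z1 * z2 * z3 * (fb * gb) - z1 by rewrite -S; ring.
rewrite S' in S1; combine2 (fun x y : K => - x - fb * gb * y) S1 C1.
Qed.

(** With this value of k, z2 and z3 have the sum and the product of the roots of
    the quadratic attached to z1, whether or not the three points are distinct. *)
Lemma tangency_of_cubic (K : fieldType) (f g fb gb z1 z2 z3 : K) :
  z1 != 0 ->
  z1 + z2 + z3 = f + g + z1 * z2 * z3 * (fb * gb) ->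
  blaschke_cubic f g fb gb (z1 * z2 * z3) z1 = 0 ->
  tangency f g fb gb ((1 - f * fb) * (1 - g * gb)) z1 z2 = 0.
Proof.
move=> z0 S C.
have C' : (z1 - f) * (z1 - g) = z2 * z3 * (1 - z1 * fb) * (1 - z1 * gb).
  by apply: (mulfI z0); rewrite /blaschke_cubic in C; combine1 (fun x : K => x) C.
have S' : z3 = f + g + z1 * z2 * z3 * (fb * gb) - z1 - z2 by rewrite -S; ring.
apply: (mulfI z0); rewrite mulr0 /tangency.
have M : (1 - z1 * fb) * (1 - z1 * gb) * (z2 + z3)
  = (f - z1) * (1 - z1 * gb) + (g - z1) * (1 - z1 * fb)
    + (1 - f * fb) * (1 - g * gb) * z1.
  have -> : z2 + z3 = f + g + z1 * z2 * z3 * (fb * gb) - z1 by rewrite -S; ring.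
  combine1 (fun x : K => - (z1 * fb * gb * x)) C'.
combine2 (fun x y : K => z1 * (x + z2 * y)) C' M.
Qed.

(** * Tangent lines and orthocenters in the plane *)

Definition cross (R : realType) (z w : R[i]) : R :=
  complex.Re z * complex.Im w - complex.Im z * complex.Re w.

Lemma complexP (R : realType) (z w : R[i]) :
  complex.Re z = complex.Re w -> complex.Im z = complex.Im w -> z = w.
Proof. by case: z w => [x y] [x' y'] /= -> ->. Qed.

Lemma dot_conj (R : realType) (z w : R[i]) :
  2 * (dot z w)%:C = z^* * w + z * w^*.
Proof. by case: z w => [x y] [x' y']; apply: complexP; rewrite /dot /=; ring. Qed.

Lemma cross_conj (R : realType) (z w : R[i]) :
  2 * 'i%C * (cross z w)%:C = z^* * w - z * w^*.
Proof. by case: z w => [x y] [x' y']; apply: complexP; rewrite /cross /=; ring. Qed.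

Lemma sum_sqr_eq0 (R : realType) (x y : R) :
  x ^+ 2 + y ^+ 2 = 0 -> x = 0 /\ y = 0.
Proof.
move=> /eqP; rewrite paddr_eq0 ?sqr_ge0 // !sqrf_eq0.
by case/andP=> /eqP -> /eqP ->.
Qed.

Lemma dot_eq0 (R : realType) (z : R[i]) : dot z z = 0 -> z = 0.
Proof.
by rewrite /dot -!expr2 => /sum_sqr_eq0 [x0 y0]; apply: complexP; rewrite ?x0 ?y0.
Qed.

Lemma dot_gt0 (R : realType) (z : R[i]) : z <> 0 -> 0 < dot z z.
Proof.
move=> z0; rewrite lt0r; apply/andP; split.
  by apply/eqP => /dot_eq0.
by rewrite /dot -!expr2 addr_ge0 ?sqr_ge0.
Qed.

Lemma noncollinear_cross (R : realType) (A B C : R[i]) :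
  noncollinear A B C <-> cross (B - A) (C - A) <> 0.
Proof.
split=> [[AB nC] cr0|cr].
  apply: nC; exists (dot (B - A) (C - A) / dot (B - A) (B - A)).
  have d0 : dot (B - A) (B - A) != 0.
    by rewrite gt_eqF // dot_gt0 // => /subr0_eq BA; apply: AB.
  case: A B C AB cr0 d0 => [a1 a2] [b1 b2] [c1 c2] _.
  rewrite /cross /dot /= => cr0 d0; apply: complexP; rewrite /=.
    apply: (mulfI d0).
    by apply: (eq_of_sub_eq (congr1 (fun x => - (b2 - a2) * x) cr0)) => /=; field.
  apply: (mulfI d0).
  by apply: (eq_of_sub_eq (congr1 (fun x => (b1 - a1) * x) cr0)) => /=; field.
split=> [AB|[t Ct]]; apply: cr.
  by rewrite AB subrr /cross /= !mul0r subrr.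
rewrite Ct; case: A B {Ct} => [a1 a2] [b1 b2]; rewrite /cross /=; ring.
Qed.

(** Two of the three altitude conditions form a linear system in H whose
    determinant is twice the area of the triangle. *)
Lemma orthocenter_unique (R : realType) (A B C H H' : R[i]) :
  noncollinear A B C -> orthocenter A B C H -> orthocenter A B C H' -> H = H'.
Proof.
move=> /noncollinear_cross; case: A B C H H' => [a1 a2] [b1 b2] [c1 c2] [h1 h2] [k1 k2].
rewrite /orthocenter /cross /dot /= => /eqP cr [E1 E2 _] [F1 F2 _].
apply: complexP; rewrite /=; apply: (mulfI cr).
  apply: (eq_of_sub_eq (congr2 (fun x y => (c2 - a2) * x + (c2 - b2) * y)
    (congr2 (fun x y => x - y) E1 F1) (congr2 (fun x y => x - y) E2 F2))).
  by rewrite /=; ring.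
apply: (eq_of_sub_eq (congr2 (fun x y => - (c1 - a1) * x - (c1 - b1) * y)
    (congr2 (fun x y => x - y) E1 F1) (congr2 (fun x y => x - y) E2 F2))).
by rewrite /=; ring.
Qed.

(** The reflection t |-> - 2 be / al - t permutes the roots, so a unique root is
    fixed by it. *)
Lemma quadratic_unique_root (R : realType) (al be ga : R) :
  al != 0 ->
  (exists! t, al * t ^+ 2 + 2 * be * t + ga = 0) <-> be ^+ 2 = al * ga.
Proof.
move=> al0; split=> [[t [Et Ut]]|E].
  have /Ut tE : al * (- 2 * be / al - t) ^+ 2 + 2 * be * (- 2 * be / al - t) + ga = 0.
    by rewrite -Et; field.
  have bE : be = - (al * t).
    apply: (@mulfI _ 2); first by rewrite pnatr_eq0.
    by apply: (eq_of_sub_eq (congr1 (fun x => al * x) tE)); rewrite /=; field.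
  apply: (eq_of_sub_eq (congr1 (fun x => - al * x) Et)).
  by rewrite bE /=; ring.
have complete t : al * (al * t ^+ 2 + 2 * be * t + ga) = (al * t + be) ^+ 2.
  by apply: (eq_of_sub_eq (congr1 (fun x => - x) E)); rewrite /=; ring.
exists (- be / al); split=> [|t Et].
  by apply: (mulfI al0); rewrite complete mulr0; field.
apply: (mulfI al0); move/eqP: (complete t); rewrite Et mulr0 eq_sym sqrf_eq0 => /eqP E'.
by rewrite [al * _]mulrC divfK // -[LHS]addr0 -E'; ring.
Qed.

Lemma dot_unit (R : realType) (u : R[i]) : modulus u = 1 -> dot u u = 1.
Proof.
case: u => x y; rewrite /modulus /ComplexField.Normc.normc /dot /= => m1.
by rewrite -!expr2 -[LHS]sqr_sqrtr ?addr_ge0 ?sqr_ge0 // m1 expr1n.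
Qed.

Lemma ellipse_curve_eq (R : realType) (O u z : R[i]) (p q : R) :
  modulus u = 1 -> p != 0 -> q != 0 ->
  ellipse_curve O u p q z <->
  (dot u (z - O) / p) ^+ 2 + (cross u (z - O) / q) ^+ 2 = 1.
Proof.
move=> /dot_unit; case: u O => [u1 u2] [o1 o2] u1E p0 q0.
split=> [[s [t [st ->]]]|zE].
  rewrite -st /cross; rewrite /dot /= in u1E *.
  congr (_ ^+ 2 + _ ^+ 2).
    by apply: (mulIf p0); rewrite divfK // -[RHS]mul1r -u1E; ring.
  by apply: (mulIf q0); rewrite divfK // -[RHS]mul1r -u1E; ring.
exists (dot (u1 +i* u2) (z - (o1 +i* o2)) / p),
  (cross (u1 +i* u2) (z - (o1 +i* o2)) / q).
split=> //; case: z {zE} => z1 z2; rewrite /cross; rewrite /dot /= in u1E *.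
apply: complexP; rewrite /=.
  apply: (eq_of_sub_eq (congr1 (fun x => - (z1 - o1) * x) u1E)).
  by rewrite /=; field; rewrite p0 q0.
apply: (eq_of_sub_eq (congr1 (fun x => - (z2 - o2) * x) u1E)).
by rewrite /=; field; rewrite p0 q0.
Qed.

(** In the frame of the ellipse, scaling the axes by 1/p and 1/q turns it into the
    unit circle, and the line meets it once exactly when a discriminant vanishes.
    That condition is (x dy - y dx)^2 = q^2 dx^2 + p^2 dy^2, with (x, y) and
    (dx, dy) the coordinates of P and Q - P in the frame.  Subtracting c0^2 dy^2,
    where c0^2 = p^2 - q^2, turns the left side into the product of the signed
    distances to the foci and the right side into q^2 |Q - P|^2. *)
Lemma tangent_ellipse (R : realType) (O u P Q : R[i]) (p q : R) :
  modulus u = 1 -> 0 < q -> q <= p -> P <> Q ->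
  let c := (Num.sqrt (p ^+ 2 - q ^+ 2))%:C * u in
  tangent (line P Q) (ellipse_curve O u p q) <->
  cross (P - (O + c)) (Q - P) * cross (P - (O - c)) (Q - P)
    = q ^+ 2 * dot (Q - P) (Q - P).
Proof.
move=> um q_gt0 qp PQ.
have p_gt0 : 0 < p by exact: lt_le_trans qp.
have [p0 q0] : p != 0 /\ q != 0 by rewrite !gt_eqF.
have D0 : Q - P <> 0 by move/subr0_eq => QP; apply: PQ.
set c0 := Num.sqrt _ => c.
have c2 : c0 ^+ 2 = p ^+ 2 - q ^+ 2.
  by rewrite sqr_sqrtr // subr_ge0 ler_pXn2r // nnegrE ltW.
have uu := dot_unit um.
set D := Q - P in D0 *.
pose x := dot u (P - O); pose y := cross u (P - O).
pose dx := dot u D; pose dy := cross u D.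
have dE : dot D D = dx ^+ 2 + dy ^+ 2.
  rewrite -[LHS]mul1r -uu /dx /dy /dot /cross; ring.
have crE : cross (P - O) D = x * dy - y * dx.
  by rewrite -[LHS]mul1r -uu /x /y /dx /dy /dot /cross; ring.
have cr1 : cross (P - (O + c)) D = x * dy - y * dx - c0 * dy.
  rewrite -crE /dy /c /cross; case: (u) (P) (O) (D) => [? ?] [? ?] [? ?] [? ?] /=; ring.
have cr2 : cross (P - (O - c)) D = x * dy - y * dx + c0 * dy.
  rewrite -crE /dy /c /cross; case: (u) (P) (O) (D) => [? ?] [? ?] [? ?] [? ?] /=; ring.
rewrite cr1 cr2 dE.
pose al := (dx / p) ^+ 2 + (dy / q) ^+ 2.
pose be := (x / p) * (dx / p) + (y / q) * (dy / q).
pose ga := (x / p) ^+ 2 + (y / q) ^+ 2 - 1.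
have memE t : ellipse_curve O u p q (P + t%:C * D) <->
    al * t ^+ 2 + 2 * be * t + ga = 0.
  rewrite ellipse_curve_eq //.
  have -> : dot u (P + t%:C * D - O) = x + t * dx.
    rewrite /x /dx /dot; case: (u) (P) (O) (D) => [? ?] [? ?] [? ?] [? ?] /=; ring.
  have -> : cross u (P + t%:C * D - O) = y + t * dy.
    rewrite /y /dy /cross; case: (u) (P) (O) (D) => [? ?] [? ?] [? ?] [? ?] /=; ring.
  have -> : al * t ^+ 2 + 2 * be * t + ga
      = ((x + t * dx) / p) ^+ 2 + ((y + t * dy) / q) ^+ 2 - 1.
    by rewrite /al /be /ga; ring.
  by split=> [-> | /subr0_eq]; rewrite ?subrr.
have al0 : al != 0.
  apply/eqP => /sum_sqr_eq0 [/eqP + /eqP]; rewrite !mulf_eq0 !invr_eq0.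
  rewrite (negPf p0) (negPf q0) !orbF => /eqP dx0 /eqP dy0.
  by apply: D0; apply: dot_eq0; rewrite dE dx0 dy0 expr0n addr0.
have lineI t t' : P + t%:C * D = P + t'%:C * D -> t = t'.
  by move/addrI/(mulIf (introN eqP D0)) => /complexI.
transitivity (exists! t, al * t ^+ 2 + 2 * be * t + ga = 0).
  split=> [[z [[[t ->] /memE Et] U]]|[t [/memE Et U]]].
    exists t; split=> // t' /memE Et'; apply: lineI; apply: U; split=> //.
    by exists t'.
  exists (P + t%:C * D); split=> [|z [[t' ->] /memE Et']].
    by split=> //; exists t.
  by rewrite (U t').
rewrite quadratic_unique_root //.
have pq0 : (p * q) ^+ 2 != 0 by rewrite sqrf_eq0 mulf_neq0.
have key : (p * q) ^+ 2 * (be ^+ 2 - al * ga) =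
    q ^+ 2 * (dx ^+ 2 + dy ^+ 2)
    - (x * dy - y * dx - c0 * dy) * (x * dy - y * dx + c0 * dy).
  apply: (eq_of_sub_eq (congr1 (fun k => - dy ^+ 2 * k) c2)).
  by rewrite /= /al /be /ga; field; rewrite p0 q0.
split=> E.
  by apply/esym/subr0_eq; rewrite -key E subrr mulr0.
by apply/subr0_eq/(mulfI pq0); rewrite key E subrr mulr0.
Qed.

(** * Chords of the unit circle *)

Lemma conjcB (R : realType) (z w : R[i]) : (z - w)^* = z^* - w^*.
Proof. exact: rmorphB. Qed.

Lemma conjcD (R : realType) (z w : R[i]) : (z + w)^* = z^* + w^*.
Proof. exact: rmorphD. Qed.

Lemma conjcM (R : realType) (z w : R[i]) : (z * w)^* = z^* * w^*.
Proof. exact: rmorphM. Qed.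

Lemma unit_conj (R : realType) (z : R[i]) : z * z^* = 1 -> z != 0 /\ z^* = z^-1.
Proof.
move=> zz; have z0 : z != 0.
  by apply/eqP => z0; move/eqP: zz; rewrite z0 mul0r eq_sym oner_eq0.
by split=> //; apply: (mulfI z0); rewrite zz divff.
Qed.

(** Conjugation being inversion on the circle, the distance from f to the chord is
    f + z w f^* - z - w up to a factor that depends on z and w only. *)
Lemma chord_tangency (R : realType) (f g z w : R[i]) (k : R) :
  z * z^* = 1 -> w * w^* = 1 -> z <> w ->
  cross (z - f) (w - z) * cross (z - g) (w - z) = k * dot (w - z) (w - z) <->
  tangency f g f^* g^* (4 * k%:C) z w = 0.
Proof.
move=> /unit_conj [z0 zc] /unit_conj [w0 wc] /eqP zw.
have wz0 : w - z != 0 by rewrite subr_eq0 eq_sym.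
set c1 := cross _ _; set c2 := cross _ _; set d := dot _ _.
have E1 : 2 * 'i%C * c1%:C * (z * w) = - (w - z) * (f + z * w * f^* - z - w).
  by rewrite cross_conj !conjcB zc wc; field; rewrite z0 w0.
have E2 : 2 * 'i%C * c2%:C * (z * w) = - (w - z) * (g + z * w * g^* - z - w).
  by rewrite cross_conj !conjcB zc wc; field; rewrite z0 w0.
have Ed : 2 * d%:C * (z * w) = - 2 * (w - z) ^+ 2.
  by rewrite dot_conj !conjcB zc wc; field; rewrite z0 w0.
have key : 4 * (z * w) ^+ 2 * (c1 * c2 - k * d)%:C =
    - (w - z) ^+ 2 * tangency f g f^* g^* (4 * k%:C) z w.
  apply: (@eq_of_sub_eq _ _ _
    (- ((2 * 'i%C * c1%:C * (z * w)) * (2 * 'i%C * c2%:C * (z * w)))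
     - 2 * (k%:C * (z * w)) * (2 * d%:C * (z * w))
     + 4 * (z * w) ^+ 2 * c1%:C * c2%:C * 'i%C ^+ 2)
    (- ((- (w - z) * (f + z * w * f^* - z - w))
        * (- (w - z) * (g + z * w * g^* - z - w)))
     - 2 * (k%:C * (z * w)) * (- 2 * (w - z) ^+ 2)
     + 4 * (z * w) ^+ 2 * c1%:C * c2%:C * (-1))).
    by rewrite E1 E2 Ed sqr_i.
  by rewrite rmorphB /= !rmorphM /tangency; ring.
have n1 : 4 * (z * w) ^+ 2 != 0 by rewrite mulf_neq0 ?pnatr_eq0 // sqrf_eq0 mulf_neq0.
have n2 : - (w - z) ^+ 2 != 0 by rewrite oppr_eq0 sqrf_eq0.
split=> E.
  by apply: (mulfI n2); rewrite -key E subrr !mulr0.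
apply/subr0_eq/complexI/(mulfI n1).
by rewrite key E !mulr0.
Qed.

(** * The orthocenter of a triangle inscribed in the outer ellipse *)

Definition unit_disk_unmap (R : realType) (a b : R) (z : R[i]) : R[i] :=
  (a * complex.Re z) +i* (b * complex.Im z).

(** The orthocenter of the triangle of vertices A_k = al z_k + be z_k^*, where
    |z_k| = 1, in terms of the sum s and the product l of the z_k.  It is
    A_1 + A_2 + A_3 - 2 O with O the circumcenter.  The parameters of the points
    that a circle shares with the ellipse are the roots of a quartic whose outer
    coefficients are equal, so their product is 1: the fourth one is l^*, and the
    sum s + l^* of the four determines O. *)
Definition inscribed_orthocenter (R : realType) (a b : R) (s l : R[i]) : R[i] :=
  let al := ((a + b) / 2)%:C in let be := ((a - b) / 2)%:C in
  al * s + be * s^* - (2 * al * be / (a * b)%:C) * (al * (s^* + l) - be * (s + l^*)).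

Lemma unit_disk_unmapE (R : realType) (a b : R) (z : R[i]) :
  unit_disk_unmap a b z = ((a + b) / 2)%:C * z + ((a - b) / 2)%:C * z^*.
Proof.
by case: z => x y; apply: complexP; rewrite /=; field.
Qed.

Lemma inscribed_altitude (R : realType) (a b : R) (z1 z2 z3 : R[i]) :
  0 < a -> 0 < b -> z1 * z1^* = 1 -> z2 * z2^* = 1 -> z3 * z3^* = 1 ->
  dot (inscribed_orthocenter a b (z1 + z2 + z3) (z1 * z2 * z3) - unit_disk_unmap a b z1)
      (unit_disk_unmap a b z2 - unit_disk_unmap a b z3) = 0.
Proof.
move=> a0 b0 /unit_conj [n1 c1] /unit_conj [n2 c2] /unit_conj [n3 c3].
apply: complexI; apply: (@mulfI _ 2); first by rewrite pnatr_eq0.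
rewrite dot_conj mulr0 !unit_disk_unmapE /inscribed_orthocenter.
have -> : (a * b)%:C = ((a + b) / 2)%:C ^+ 2 - ((a - b) / 2)%:C ^+ 2.
  by rewrite -!rmorphXn -rmorphB; congr (_%:C); field.
have : ((a + b) / 2)%:C ^+ 2 - ((a - b) / 2)%:C ^+ 2 != 0.
  have -> : ((a + b) / 2)%:C ^+ 2 - ((a - b) / 2)%:C ^+ 2 = (a * b)%:C.
    by rewrite -!rmorphXn -rmorphB; congr (_%:C); field.
  by rewrite fmorph_eq0 mulf_neq0 ?gt_eqF.
move: ((a + b) / 2) ((a - b) / 2) => al be ab0.
rewrite !expr2 in ab0 *.
rewrite !(conjcB, conjcD, conjcM, conjc_inv, conjcK, conjc_real, conjc_nat).
rewrite c1 c2 c3 ?conjc_inv.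
field.
by rewrite n1 n2 n3 ab0.
Qed.

(** * Poncelet triangles in the unit disk *)

Lemma mulc_conj (R : realType) (z : R[i]) : z * z^* = (dot z z)%:C.
Proof. by case: z => x y; apply: complexP; rewrite /dot /=; ring. Qed.

Lemma dotM (R : realType) (z w : R[i]) :
  dot (z * w) (z * w) = dot z z * dot w w.
Proof. by case: z w => [x y] [x' y']; rewrite /dot /=; ring. Qed.

Lemma dot_ge0 (R : realType) (z : R[i]) : 0 <= dot z z.
Proof. by rewrite /dot -!expr2 addr_ge0 ?sqr_ge0. Qed.

Lemma dot_blaschke (R : realType) (f z : R[i]) :
  dot (z - f) (z - f) = dot (1 - z * f^*) (1 - z * f^*)
    + (dot z z - 1) * (1 - dot f f).
Proof. by case: z f => [x y] [x' y']; rewrite /dot /=; ring. Qed.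

(** Here n = |z|^2, F = |1 - z f^*|^2 and F + (n - 1) ph = |z - f|^2, likewise for
    g.  If n > 1 then all three factors on the left exceed those on the right, and
    conversely if n < 1. *)
Lemma blaschke_balance (R : realDomainType) (n F G ph ga : R) :
  0 <= F -> 0 <= G -> 0 < ph -> 0 < ga ->
  0 <= F + (n - 1) * ph -> 0 <= G + (n - 1) * ga ->
  n * (F + (n - 1) * ph) * (G + (n - 1) * ga) = F * G -> n = 1.
Proof.
move=> F0 G0 ph0 ga0 X0 Y0; rewrite -mulrA => E.
case: (ltrgtP n 1) => // n1; exfalso.
  have : (F + (n - 1) * ph) * (G + (n - 1) * ga) < F * G.
    by apply: ltr_pM; rewrite // gtrDl pmulr_llt0 // subr_lt0.
  by rewrite -E ltNge ler_piMl ?mulr_ge0 // ltW.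
have : F * G < (F + (n - 1) * ph) * (G + (n - 1) * ga).
  by apply: ltr_pM; rewrite // ltrDl pmulr_lgt0 // subr_gt0.
by rewrite -E ltNge ler_peMl ?mulr_ge0 // ltW.
Qed.

Lemma blaschke_root_unit (R : realType) (f g l z : R[i]) :
  dot f f < 1 -> dot g g < 1 -> l * l^* = 1 ->
  blaschke_cubic f g f^* g^* l z = 0 -> z * z^* = 1.
Proof.
rewrite !mulc_conj => f1 g1 /complexI l1 /subr0_eq E; congr (_%:C).
have := congr1 (fun w => dot w w) E; rewrite /= !dotM l1 mul1r.
have := dot_ge0 (z - g); have := dot_ge0 (z - f).
rewrite (dot_blaschke f) (dot_blaschke g).
by apply: blaschke_balance; rewrite ?dot_ge0 ?subr_gt0.
Qed.

(** This is what keeps the roots of the cubic distinct.  On the diagonal the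
    relation becomes (2 - 2 f.z) (2 - 2 g.z) = (1 - |f|^2) (1 - |g|^2), but each
    factor on the left is larger: the difference of the first ones is
    |z - f|^2. *)
Lemma tangency_diag (R : realType) (f g z : R[i]) :
  dot f f < 1 -> dot g g < 1 -> z * z^* = 1 ->
  tangency f g f^* g^* ((1 - f * f^*) * (1 - g * g^*)) z z <> 0.
Proof.
move=> f1 g1 z1.
have z0 : z != 0 by have [] := unit_conj z1.
have dz : dot z z = 1 by move: z1; rewrite mulc_conj => /complexI.
have gap h : dot h h < 1 -> 0 < 1 - dot h h < 2 - 2 * dot h z.
  move=> h1; rewrite subr_gt0 h1 /= -subr_gt0.
  have -> : 2 - 2 * dot h z - (1 - dot h h) = dot (z - h) (z - h).
    transitivity (1 + dot z z - 2 * dot h z - (1 - dot h h)); first by rewrite dz.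
    by rewrite /dot; case: (z) (h) => [? ?] [? ?] /=; ring.
  apply: dot_gt0 => /subr0_eq zh.
  by move: h1; rewrite -zh dz ltxx.
have factor h : h + z * z * h^* - z - z = - z * (2 - 2 * dot h z)%:C.
  rewrite rmorphB rmorphM !rmorph_nat.
  apply: (@eq_of_sub_eq _ _ _ (- h * (z * z^*) - z * (2 * (dot h z)%:C))
    (- h * 1 - z * (h^* * z + h * z^*))); first by rewrite dot_conj z1.
  by ring.
have fac1 h : 1 - h * h^* = (1 - dot h h)%:C by rewrite mulc_conj rmorphB rmorph1.
rewrite /tangency !factor !fac1 => E.
have /andP[pf lf] := gap f f1; have /andP[pg lg] := gap g g1.
have : (1 - dot f f) * (1 - dot g g) < (2 - 2 * dot f z) * (2 - 2 * dot g z).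
  by apply: ltr_pM; rewrite ?ltW.
suff -> : (1 - dot f f) * (1 - dot g g) = (2 - 2 * dot f z) * (2 - 2 * dot g z).
  by rewrite ltxx.
apply/complexI/(mulfI (mulf_neq0 z0 z0)).
apply: (eq_of_sub_eq (congr1 (fun x => - x) E)) => /=.
by rewrite [in LHS]rmorphM [in LHS]rmorphM; ring.
Qed.

Lemma cubic_roots (K : closedFieldType) (e1 e2 l : K) : 2 != 0 :> K ->
  exists z1 z2 z3 : K, [/\ z1 + z2 + z3 = e1, z1 * z2 * z3 = l &
    forall z, z \in [:: z1; z2; z3] -> z ^+ 3 - e1 * z ^+ 2 + e2 * z = l].
Proof.
move=> two0.
pose p := Poly [:: - l; e2; - e1; 1].
have pE : polyseq p = [:: - l; e2; - e1; 1].
  by rewrite (@PolyK _ 0) //= oner_eq0.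
have [rs] := closed_field_poly_normal p.
have -> : lead_coef p = 1 by rewrite /lead_coef pE.
rewrite scale1r => E.
have : size rs = 3%N.
  by have := size_prod_XsubC rs id; rewrite -E pE => -[].
case: rs E => [|z1 [|z2 [|z3 []]]] // E _; exists z1, z2, z3.
have V x : (x - z1) * (x - z2) * (x - z3) = x ^+ 3 - e1 * x ^+ 2 + e2 * x - l.
  have := congr1 (fun q => q.[x]) E.
  rewrite !big_cons big_nil mulr1 !hornerM !hornerXsubC.
  rewrite mulrA => <-; rewrite /horner pE /=; ring.
split.
(* Comparing values at 1, -1 and 0 replaces a comparison of coefficients. *)
- apply: (mulfI two0).
  have W := congr2 (fun x y => x + y) (V 1) (V (-1)).
  by apply: (eq_of_sub_eq (congr2 (fun x y => 2 * y - x) W (V 0))) => /=; ring.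
- by apply: (eq_of_sub_eq (congr1 (fun x => - x) (V 0))) => /=; ring.
move=> z zr; apply: subr0_eq; rewrite -V.
by move: zr; rewrite !inE => /or3P[] /eqP ->; rewrite subrr !(mul0r, mulr0).
Qed.

(** Poncelet's porism in the unit disk, with the triangle indexed by the product
    of its vertices. *)
Lemma blaschke_triangle (R : realType) (f g l : R[i]) :
  dot f f < 1 -> dot g g < 1 -> l * l^* = 1 ->
  let T := tangency f g f^* g^* ((1 - f * f^*) * (1 - g * g^*)) in
  exists z1 z2 z3 : R[i],
    [/\ z1 * z1^* = 1 /\ z2 * z2^* = 1 /\ z3 * z3^* = 1,
        z1 <> z2 /\ z2 <> z3 /\ z3 <> z1,
        T z1 z2 = 0 /\ T z2 z3 = 0 /\ T z3 z1 = 0,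
        z1 * z2 * z3 = l & z1 + z2 + z3 = f + g + l * (f^* * g^*)].
Proof.
move=> f1 g1 l1 T.
have two0 : 2 != 0 :> R[i] by rewrite pnatr_eq0.
have [z1 [z2 [z3 [S P rt]]]] :=
  @cubic_roots R[i] (f + g + l * (f^* * g^*)) (f * g + l * (f^* + g^*)) l
    two0.
exists z1, z2, z3.
have cub z : z \in [:: z1; z2; z3] -> blaschke_cubic f g f^* g^* l z = 0.
  move=> /rt E; rewrite /blaschke_cubic.
  by apply: (eq_of_sub_eq E); ring.
have unit z : z \in [:: z1; z2; z3] -> z * z^* = 1.
  by move=> /cub; apply: blaschke_root_unit.
have nz z : z \in [:: z1; z2; z3] -> z != 0 by move=> /unit /unit_conj [].
have [m1 m2 m3] : [/\ z1 \in [:: z1; z2; z3], z2 \in [:: z1; z2; z3] &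
    z3 \in [:: z1; z2; z3]] by rewrite !inE !eqxx !orbT.
have T12 : T z1 z2 = 0.
  by apply: (@tangency_of_cubic _ _ _ _ _ z1 z2 z3); rewrite ?P ?nz ?cub.
have T23 : T z2 z3 = 0.
  apply: (@tangency_of_cubic _ _ _ _ _ z2 z3 z1).
  - exact: nz.
  - by rewrite -[LHS]addrC addrA S -P; ring.
  - by rewrite -[z2 * z3 * z1]mulrC mulrA P cub.
have T31 : T z3 z1 = 0.
  apply: (@tangency_of_cubic _ _ _ _ _ z3 z1 z2).
  - exact: nz.
  - by rewrite -addrA [LHS]addrC S -P; ring.
  - by rewrite -mulrA [z3 * _]mulrC P cub.
split=> //; first by rewrite !unit.
split; first by move=> e; move: T12; rewrite -e; apply: tangency_diag; rewrite ?unit.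
split; first by move=> e; move: T23; rewrite -e; apply: tangency_diag; rewrite ?unit.
by move=> e; move: T31; rewrite -e; apply: tangency_diag; rewrite ?unit.
Qed.

Lemma unit_noncollinear (R : realType) (z1 z2 z3 : R[i]) :
  z1 * z1^* = 1 -> z2 * z2^* = 1 -> z3 * z3^* = 1 ->
  z1 <> z2 -> z2 <> z3 -> z3 <> z1 -> noncollinear z1 z2 z3.
Proof.
move=> /unit_conj [n1 c1] /unit_conj [n2 c2] /unit_conj [n3 c3].
move=> /eqP z12 /eqP z23 /eqP z31; apply/noncollinear_cross => cr0.
have : 2 * 'i%C * (cross (z2 - z1) (z3 - z1))%:C * (z1 * z2 * z3)
    = (z2 - z1) * (z3 - z1) * (z2 - z3).
  by rewrite cross_conj !conjcB c1 c2 c3; field; rewrite n1 n2 n3.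
move/esym/eqP; rewrite cr0 mulr0 mul0r !mulf_eq0 !subr_eq0.
by rewrite eq_sym (negPf z12) (negPf z23) (negPf z31).
Qed.

(** * Transport to the unit disk *)

Lemma unit_disk_unmapK (R : realType) (a b : R) : 0 < a -> 0 < b ->
  cancel (unit_disk_unmap a b) (unit_disk_map a b).
Proof.
by move=> a0 b0 [x y]; apply: complexP; rewrite /= mulrC mulKf // gt_eqF.
Qed.

Lemma unit_disk_mapK (R : realType) (a b : R) : 0 < a -> 0 < b ->
  cancel (unit_disk_map a b) (unit_disk_unmap a b).
Proof.
by move=> a0 b0 [x y]; apply: complexP; rewrite /= mulrC divfK // gt_eqF.
Qed.

Lemma cross_unit_disk_unmap (R : realType) (a b : R) (A B C : R[i]) :
  let h := unit_disk_unmap a b in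
  cross (h B - h A) (h C - h A) = a * b * cross (B - A) (C - A).
Proof. by case: A B C => [? ?] [? ?] [? ?]; rewrite /cross /=; ring. Qed.

Lemma noncollinear_unit_disk_unmap (R : realType) (a b : R) (A B C : R[i]) :
  0 < a -> 0 < b -> noncollinear A B C ->
  noncollinear (unit_disk_unmap a b A) (unit_disk_unmap a b B) (unit_disk_unmap a b C).
Proof.
move=> a0 b0 /noncollinear_cross /eqP cr; apply/noncollinear_cross/eqP.
by rewrite cross_unit_disk_unmap !mulf_neq0 // gt_eqF.
Qed.

Lemma outer_ellipse_unit (R : realType) (a b : R) (z : R[i]) :
  outer_ellipse a b z <-> unit_disk_map a b z * (unit_disk_map a b z)^* = 1.
Proof.
rewrite mulc_conj /dot /= /outer_ellipse /= -!expr2 !expr_div_n.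
by split=> [->|/complexI].
Qed.

Lemma inside_unit (R : realType) (a b : R) (z : R[i]) :
  outer_ellipse_inside a b z ->
  dot (unit_disk_map a b z) (unit_disk_map a b z) < 1.
Proof. by rewrite /dot /= /outer_ellipse_inside /= -!expr2 !expr_div_n. Qed.

Lemma line_unit_disk_map (R : realType) (a b : R) (P Q : R[i]) :
  [set unit_disk_map a b z | z in line P Q]
  = line (unit_disk_map a b P) (unit_disk_map a b Q).
Proof.
have E t : unit_disk_map a b (P + t%:C * (Q - P)) =
    unit_disk_map a b P + t%:C * (unit_disk_map a b Q - unit_disk_map a b P).
  by case: P Q => [? ?] [? ?]; apply: complexP; rewrite /=; ring.
apply/seteqP; split=> z; first by case=> w [t ->] <-; exists t.
by case=> t ->; exists (P + t%:C * (Q - P)); [exists t | rewrite E].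
Qed.

Lemma tangent_image (R : realType) (h k : R[i] -> R[i]) (L S : set R[i]) :
  cancel h k -> tangent L S <-> tangent (h @` L) (h @` S).
Proof.
move=> hk; split=> [[z [[Lz Sz] U]]|[_ [[[z Lz <-] [z' Sz' /(can_inj hk) zz]] U]]].
  exists (h z); split=> [|_ [[w Lw <-] [w' Sw' /(can_inj hk) ww]]].
    by split; exists z.
  by rewrite (U w) //; split=> //; rewrite -ww.
rewrite zz in Sz'; exists z; split=> // w [Lw Sw].
by apply: (can_inj hk); apply: U; split; exists w.
Qed.

(** The two opposite vertices O - p u and O + p u are reflected in O' to points of
    the curve; by the parallelogram law in the norm whose unit sphere is the
    centered curve, O' - O has norm 0. *)
Lemma ellipse_curve_center_unique (R : realType) (S : set R[i]) (O u O' : R[i])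
    (p q : R) :
  is_ellipse S O u p q -> (forall z, S z -> S (O' + O' - z)) -> O' = O.
Proof.
case=> um q0 qp ->{S} sym.
have p0 : 0 < p by exact: lt_le_trans qp.
have memE z := ellipse_curve_eq O z um (lt0r_neq0 p0) (lt0r_neq0 q0).
have vertex s : s ^+ 2 = 1 -> ellipse_curve O u p q (O + u * (p * s)%:C).
  by move=> s1; exists s, 0; rewrite s1 expr0n addr0 mulr0.
have /memE := sym _ (vertex 1 (expr1n _ _)).
have /memE := sym _ (vertex (-1) (etrans (sqrrN 1) (expr1n _ 2))).
have uu := dot_unit um.
rewrite mulr1 mulrN1.
have dE s : dot u (O' + O' - (O + u * s%:C) - O) = 2 * dot u (O' - O) - s.
  apply: (eq_of_sub_eq (congr1 (fun x => - s * x) uu)) => /=.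
  by rewrite /dot; case: (u) (O) (O') => [? ?] [? ?] [? ?] /=; ring.
have cE s : cross u (O' + O' - (O + u * s%:C) - O) = 2 * cross u (O' - O).
  rewrite /cross; case: (u) (O) (O') => [? ?] [? ?] [? ?] /=; ring.
rewrite !dE !cE => E1 E2.
have /sum_sqr_eq0 [/eqP + /eqP] :
    (dot u (O' - O) / p) ^+ 2 + (cross u (O' - O) / q) ^+ 2 = 0.
  apply: (@mulfI _ 8); first by rewrite pnatr_eq0.
  apply: (eq_of_sub_eq (congr2 (fun x y => x + y) E1 E2)) => /=.
  by field; rewrite !gt_eqF.
rewrite !mulf_eq0 !invr_eq0 (gt_eqF p0) (gt_eqF q0) !orbF => /eqP d0 /eqP c0.
apply/subr0_eq/dot_eq0; rewrite -[LHS]mul1r -uu.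
transitivity (dot u (O' - O) ^+ 2 + cross u (O' - O) ^+ 2).
  by rewrite /dot /cross; ring.
by rewrite d0 c0 expr0n addr0.
Qed.

(** |O + x u|^2 is convex in x, so on [-p, p] it is bounded by its values at the
    endpoints. *)
Lemma focus_in_disk (R : realType) (O u : R[i]) (p c : R) :
  0 <= p -> `|c| <= p -> dot (O + p%:C * u) (O + p%:C * u) < 1 ->
  dot (O - p%:C * u) (O - p%:C * u) < 1 -> dot (O + c%:C * u) (O + c%:C * u) < 1.
Proof.
have E x : dot (O + x%:C * u) (O + x%:C * u)
    = dot O O + 2 * x * dot O u + x ^+ 2 * dot u u.
  by rewrite /dot; case: (O) (u) => [? ?] [? ?] /=; ring.
have -> : O - p%:C * u = O + (- p)%:C * u by rewrite rmorphN mulNr.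
rewrite !E => p0 cp.
have c2 : c ^+ 2 * dot u u <= p ^+ 2 * dot u u.
  by rewrite ler_wpM2r ?dot_ge0 // -(real_normK (num_real c)) ler_pXn2r ?nnegrE.
move: cp; rewrite ler_norml => /andP[c1 c1'] h1 h2.
have [d0|d0] := leP 0 (dot O u).
  by apply: le_lt_trans h1; nra.
by apply: le_lt_trans h2; nra.
Qed.

Lemma orthocenter_inscribed (R : realType) (a b : R) (z1 z2 z3 : R[i]) :
  0 < a -> 0 < b -> z1 * z1^* = 1 -> z2 * z2^* = 1 -> z3 * z3^* = 1 ->
  orthocenter (unit_disk_unmap a b z1) (unit_disk_unmap a b z2)
    (unit_disk_unmap a b z3)
    (inscribed_orthocenter a b (z1 + z2 + z3) (z1 * z2 * z3)).
Proof.
move=> a0 b0 u1 u2 u3; split; first exact: inscribed_altitude.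
  have -> : z1 + z2 + z3 = z2 + z3 + z1 by ring.
  have -> : z1 * z2 * z3 = z2 * z3 * z1 by ring.
  exact: inscribed_altitude.
have -> : z1 + z2 + z3 = z3 + z1 + z2 by ring.
have -> : z1 * z2 * z3 = z3 * z1 * z2 by ring.
exact: inscribed_altitude.
Qed.

(** With k = f g (a^2 + b^2) - (a^2 - b^2), the coefficient of l is a real multiple
    of k^* and that of l^* a real multiple of k; the remaining terms only involve
    f + g and give the center. *)
Lemma inscribed_orthocenter_blaschke (R : realType) (a b x y : R) (f g l : R[i]) :
  0 < a -> 0 < b -> f + g = (2 * (x / a)) +i* (2 * (y / b)) ->
  let v := (f * g * (a ^+ 2 + b ^+ 2)%:C - (a ^+ 2 - b ^+ 2)%:C)^* * l in
  inscribed_orthocenter a b (f + g + l * (f^* * g^*)) l =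
  ((a ^+ 2 + b ^+ 2) * (x / a ^+ 2)) +i* ((a ^+ 2 + b ^+ 2) * (y / b ^+ 2))
  + (complex.Re v / (2 * a)) +i* (complex.Im v / (2 * b)).
Proof.
move=> a0 b0 ->; rewrite -conjcM; move: (f * g) => [f1 f2]; case: l => l1 l2.
rewrite /inscribed_orthocenter.
have -> : 2 * ((a + b) / 2)%:C * ((a - b) / 2)%:C / (a * b)%:C
    = ((a ^+ 2 - b ^+ 2) / (2 * (a * b)))%:C.
  rewrite -[2](rmorph_nat (real_complex R)) -!rmorphM -fmorphV -rmorphM /=.
  by congr (_%:C); field; rewrite !gt_eqF.
by apply: complexP; rewrite /=; field; rewrite !gt_eqF.
Qed.

Lemma inscribed_chord_tangent (R : realType) (a b : R) (Ec : set R[i])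
    (O u f g z w : R[i]) (p q : R) :
  0 < a -> 0 < b -> is_ellipse [set unit_disk_map a b z | z in Ec] O u p q ->
  f = O + (Num.sqrt (p ^+ 2 - q ^+ 2))%:C * u ->
  g = O - (Num.sqrt (p ^+ 2 - q ^+ 2))%:C * u ->
  z * z^* = 1 -> w * w^* = 1 -> z <> w ->
  tangent (line (unit_disk_unmap a b z) (unit_disk_unmap a b w)) Ec <->
  tangency f g f^* g^* (4 * (q ^+ 2)%:C) z w = 0.
Proof.
move=> a0 b0 [um q0 qp ES] fE gE z1 w1 zw.
rewrite (tangent_image _ _ (unit_disk_mapK a0 b0)) line_unit_disk_map ES.
rewrite !(unit_disk_unmapK a0 b0) (tangent_ellipse _ um q0 qp zw) -fE -gE.
exact: chord_tangency.
Qed.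

(** The foci lie between the two vertices on the major axis, which are inside the
    disk. *)
Lemma foci_in_disk (R : realType) (S : set R[i]) (O u : R[i]) (p q : R) :
  is_ellipse S O u p q -> (forall z, S z -> dot z z < 1) ->
  let c := Num.sqrt (p ^+ 2 - q ^+ 2) in
  dot (O + c%:C * u) (O + c%:C * u) < 1 /\ dot (O - c%:C * u) (O - c%:C * u) < 1.
Proof.
move=> [um q0 qp ->] inside c.
have p0 : 0 <= p by rewrite ltW // (lt_le_trans q0).
have cp : `|c| <= p.
  rewrite ger0_norm ?sqrtr_ge0 // -[leRHS](ger0_norm p0) -sqrtr_sqr.
  by rewrite ler_wsqrtr // gerBl sqr_ge0.
have vertex s : s ^+ 2 = 1 -> dot (O + (s * p)%:C * u) (O + (s * p)%:C * u) < 1.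
  move=> s1; apply: inside; exists s, 0; rewrite s1 expr0n addr0 mulr0; split=> //.
  by rewrite mulrC [s * p]mulrC.
have v1 := vertex 1 (expr1n _ _).
have v2 := vertex (-1) (etrans (sqrrN 1) (expr1n _ 2)).
rewrite mul1r in v1; rewrite mulN1r rmorphN mulNr in v2.
split; first exact: (focus_in_disk p0).
rewrite -mulNr -rmorphN; apply: (focus_in_disk p0) => //.
by rewrite normrN.
Qed.

(** * The locus of the orthocenter *)

Lemma poncelet_triangle_disk (R : realType) (a b : R) (Ec : set R[i])
    (O u f g A B C : R[i]) (p q : R) :
  0 < a -> 0 < b -> is_ellipse [set unit_disk_map a b z | z in Ec] O u p q ->
  f = O + (Num.sqrt (p ^+ 2 - q ^+ 2))%:C * u ->
  g = O - (Num.sqrt (p ^+ 2 - q ^+ 2))%:C * u ->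
  poncelet_triangle a b Ec A B C ->
  exists z1 z2 z3 : R[i],
    [/\ [/\ A = unit_disk_unmap a b z1, B = unit_disk_unmap a b z2 &
            C = unit_disk_unmap a b z3],
        [/\ z1 * z1^* = 1, z2 * z2^* = 1 & z3 * z3^* = 1],
        z1 + z2 + z3 = f + g + z1 * z2 * z3 * (f^* * g^*) &
        4 * (q ^+ 2)%:C = (1 - f * f^*) * (1 - g * g^*)].
Proof.
move=> a0 b0 ell fE gE [[AB nC]].
case=> /outer_ellipse_unit uA /outer_ellipse_unit uB /outer_ellipse_unit uC.
have CA : C <> A by move=> E; apply: nC; exists 0; rewrite mul0r addr0.
have BC : B <> C.
  by move=> E; apply: nC; exists 1; rewrite mul1r addrC subrK.
have inj := can_inj (unit_disk_mapK a0 b0).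
rewrite -(unit_disk_mapK a0 b0 A) -(unit_disk_mapK a0 b0 B) -(unit_disk_mapK a0 b0 C).
move: (unit_disk_map a b A) (unit_disk_map a b B) (unit_disk_map a b C)
  (contra_not (inj A B) AB) (contra_not (inj B C) BC)
  (contra_not (inj C A) CA) uA uB uC.
move=> z1 z2 z3 z12 z23 z31 u1 u2 u3.
case=> /(inscribed_chord_tangent a0 b0 ell fE gE u1 u2 z12) T12.
move=> /(inscribed_chord_tangent a0 b0 ell fE gE u2 u3 z23) T23.
move=> /(inscribed_chord_tangent a0 b0 ell fE gE u3 u1 z31) T31.
have [z0 _] := unit_conj u1.
have [S k] := tangency_triangle z0 (introN eqP z12)
  (introN eqP (fun e => z31 (esym e))) (introN eqP z23) T12 T23 T31.
by exists z1, z2, z3.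
Qed.

(** The porism hypothesis enters through the relation 4 q^2 = (1 - |f|^2)
    (1 - |g|^2), without which the triangles built from the cubic would not
    circumscribe the inner ellipse. *)
Lemma X4_locus_blaschke (R : realType) (a b : R) (Ec : set R[i]) (f g : R[i]) :
  0 < a -> 0 < b -> Ec `<=` outer_ellipse_inside a b ->
  (exists A B C, poncelet_triangle a b Ec A B C) ->
  foci [set unit_disk_map a b z | z in Ec] f g ->
  X4_locus a b Ec =
  [set inscribed_orthocenter a b (f + g + l * (f^* * g^*)) l
    | l in [set l | l * l^* = 1]].
Proof.
move=> a0 b0 nested porism [O [u [p [q [ell fE gE]]]]].
have [f1 g1] : dot f f < 1 /\ dot g g < 1.
  rewrite fE gE; apply: (foci_in_disk ell) => _ [z Ez <-].
  exact/inside_unit/nested.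
have [A0 [B0 [C0 tr0]]] := porism.
have [_ [_ [_ [_ _ _ k]]]] := poncelet_triangle_disk a0 b0 ell fE gE tr0.
apply/seteqP; split=> [H [A [B [C [tr orth]]]]|_ [l l1 <-]].
  have [z1 [z2 [z3 [[AE BE CE] [u1 u2 u3] S _]]]] :=
    poncelet_triangle_disk a0 b0 ell fE gE tr.
  exists (z1 * z2 * z3).
    by rewrite /= !conjcM [LHS]mulrACA [X in X * _]mulrACA u1 u2 u3 !mulr1.
  rewrite -S; case: tr => nonc _ _.
  apply: (orthocenter_unique nonc) => //.
  by rewrite AE BE CE; apply: orthocenter_inscribed.
have [z1 [z2 [z3 [[u1 [u2 u3]] [z12 [z23 z31]] [T12 [T23 T31]] P S]]]] :=
  blaschke_triangle f1 g1 l1.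
exists (unit_disk_unmap a b z1), (unit_disk_unmap a b z2), (unit_disk_unmap a b z3).
split; last by rewrite -S -P; apply: orthocenter_inscribed.
split.
- by apply: noncollinear_unit_disk_unmap => //; apply: unit_noncollinear.
- by split; apply/outer_ellipse_unit; rewrite unit_disk_unmapK.
- by split; apply/(inscribed_chord_tangent a0 b0 ell fE gE) => //; rewrite k.
Qed.

Lemma image_ellipse_center (R : realType) (a b xc yc : R) (Ec : set R[i])
    (u O v : R[i]) (p q p' q' : R) :
  is_ellipse Ec (xc +i* yc) u p q ->
  is_ellipse [set unit_disk_map a b z | z in Ec] O v p' q' ->
  O = (xc / a) +i* (yc / b).
Proof.
move=> [_ _ _ ->] ell; apply/esym; apply: (ellipse_curve_center_unique ell).
move=> _ [_ [s [t [st ->]]] <-].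
exists ((xc +i* yc) + u * ((p * - s) +i* (q * - t))).
  by exists (- s), (- t); rewrite !sqrrN.
by apply: complexP; case: (u) => u1 u2 /=; ring.
Qed.

Lemma modulusE (R : realType) (z : R[i]) : modulus z = Num.sqrt (dot z z).
Proof.
by case: z => x y; rewrite /modulus /ComplexField.Normc.normc /dot /= -!expr2.
Qed.

Lemma conj_orbit_circle (R : realType) (k w : R[i]) :
  (exists2 l : R[i], l * l^* = 1 & w = k^* * l) <-> modulus w = modulus k.
Proof.
rewrite !modulusE; split=> [[l l1 ->]|wk].
  move: l1; rewrite mulc_conj dotM => /complexI ->; rewrite mulr1; congr Num.sqrt.
  by case: (k) => x y; rewrite /dot /=; ring.
have {}wk : dot w w = dot k k.
  by rewrite -(sqr_sqrtr (dot_ge0 w)) wk sqr_sqrtr // dot_ge0.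
have [k0|/eqP k0] := pselect (k = 0).
  exists 1; first by rewrite conjc1 mulr1.
  rewrite k0 conjc0 mul0r; apply: dot_eq0; rewrite wk k0 /dot /=; ring.
have kc0 : k^* != 0 by rewrite conjc_eq0.
exists (w / k^*); last by rewrite mulrC divfK.
rewrite conjcM conjc_inv conjcK mulrACA mulc_conj wk -mulc_conj.
by rewrite -invfM [k^* * k]mulrC divff // mulf_neq0.
Qed.

Lemma circle_ellipse_curve (R : realType) (a b x y r : R) :
  0 < a -> 0 < b -> 0 <= r ->
  [set (x +i* y) + (complex.Re w / (2 * a)) +i* (complex.Im w / (2 * b))
    | w in [set w : R[i] | modulus w = r]]
  = ellipse_curve (x +i* y) 'i%C (r / (2 * b)) (r / (2 * a)).
Proof.
move=> a0 b0 r0; apply/seteqP; split=> [_ [[w1 w2] wr <-]|_ [s [t [st ->]]]].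
  have wr2 : w1 ^+ 2 + w2 ^+ 2 = r ^+ 2.
    rewrite -(wr : modulus _ = r) modulusE /dot /=.
    by rewrite sqr_sqrtr -!expr2 // addr_ge0 ?sqr_ge0.
  have [r00|r_neq0] := eqVneq r 0.
    have [w10 w20] : w1 = 0 /\ w2 = 0 by apply: sum_sqr_eq0; rewrite wr2 r00 expr0n.
    exists 1, 0; rewrite expr1n expr0n addr0; split=> //.
    by rewrite w10 w20 r00 !mul0r mulr0.
  exists (w2 / r), (- (w1 / r)); split.
    by rewrite sqrrN !expr_div_n -mulrDl addrC wr2 divff // expf_neq0.
  by apply: complexP; rewrite /=; field; rewrite r_neq0 !gt_eqF.
exists ((- (r * t)) +i* (r * s)).
  apply: (etrans (modulusE _)); rewrite /dot /=.
  have -> : - (r * t) * - (r * t) + r * s * (r * s) = r ^+ 2 * (s ^+ 2 + t ^+ 2) by ring.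
  by rewrite st mulr1 sqrtr_sqr ger0_norm.
by apply: complexP; rewrite /=; field; rewrite !gt_eqF.
Qed.

Lemma rotate90_outer_ellipse_homothetic (R : realType) (a b r : R) (O : R[i]) :
  0 < a -> 0 < b -> 0 < r ->
  homothetic (rotate90 (outer_ellipse a b))
    (ellipse_curve O 'i%C (r / (2 * b)) (r / (2 * a))).
Proof.
move=> a0 b0 r0; exists (r / (2 * (a * b))), O; split.
  by rewrite divr_gt0 // !mulr_gt0.
apply/seteqP; split=> [_ [s [t [st ->]]]|_ [_ [z zE <-] <-]].
  exists ('i%C * ((a * s) +i* (b * t))).
    exists ((a * s) +i* (b * t)) => //.
    rewrite /outer_ellipse /= !exprMn mulrC mulKf ?expf_neq0 ?gt_eqF //.
    by rewrite mulrC mulKf // expf_neq0 // gt_eqF.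
  by case: (O) => [? ?]; apply: complexP; rewrite /=; field; rewrite !gt_eqF.
exists (complex.Re z / a), (complex.Im z / b); split; first by rewrite !expr_div_n.
by case: (O) (z) => [? ?] [? ?]; apply: complexP; rewrite /=; field; rewrite !gt_eqF.
Qed.

Lemma X4_locus_ellipse (R : realType) (a b xc yc : R) (Ec : set R[i])
    (u f g : R[i]) (p q : R) :
  0 < a -> 0 < b -> is_ellipse Ec (xc +i* yc) u p q ->
  Ec `<=` outer_ellipse_inside a b ->
  (exists A B C, poncelet_triangle a b Ec A B C) ->
  foci [set unit_disk_map a b z | z in Ec] f g ->
  let r := modulus (f * g * (a ^+ 2 + b ^+ 2)%:C - (a ^+ 2 - b ^+ 2)%:C) in
  X4_locus a b Ec =
  ellipse_curve
    (((a ^+ 2 + b ^+ 2) * (xc / a ^+ 2)) +i* ((a ^+ 2 + b ^+ 2) * (yc / b ^+ 2)))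
    'i%C (r / (2 * b)) (r / (2 * a)).
Proof.
move=> a0 b0 ellc nested porism hfg r.
have fg : f + g = (2 * (xc / a)) +i* (2 * (yc / b)).
  have [O [v [p' [q' [ell -> ->]]]]] := hfg.
  have -> := image_ellipse_center ellc ell.
  by rewrite addrACA addrN addr0; apply: complexP; rewrite /=; ring.
rewrite -circle_ellipse_curve //; last by rewrite /r modulusE sqrtr_ge0.
rewrite (X4_locus_blaschke a0 b0 nested porism hfg).
have E l := inscribed_orthocenter_blaschke l a0 b0 fg.
apply/seteqP; split=> [_ [l l1 <-]|_ [w /conj_orbit_circle [l l1 wE] <-]].
  rewrite E; eexists; last reflexivity.
  by apply/conj_orbit_circle; exists l.
by exists l => //; rewrite E wE.
Qed.

Theorem theorem3 (R : realType) (a b : R) (hb : 0 < b) (hab : b <= a)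
    (Ec : set R[i]) (xc yc : R) (u : R[i]) (p q : R)
    (hEc : is_ellipse Ec (xc +i* yc) u p q)
    (hnested : Ec `<=` outer_ellipse_inside a b)
    (hporism : exists A B C : R[i], poncelet_triangle a b Ec A B C)
    (f g : R[i]) (hfg : foci [set unit_disk_map a b z | z in Ec] f g) :
  let c2 : R := a ^+ 2 - b ^+ 2 in
  let sigma : R := modulus (f * g * (a ^+ 2 + b ^+ 2)%:C - c2%:C) in
  let C4 : R[i] :=
    ((a ^+ 2 + b ^+ 2) * (xc / a ^+ 2)) +i* ((a ^+ 2 + b ^+ 2) * (yc / b ^+ 2))
    in
  let a4 : R := sigma / (2 * b) in
  let b4 : R := sigma / (2 * a) in
  [/\ X4_locus a b Ec = ellipse_curve C4 'i a4 b4,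
      0 <= sigma /\ b4 <= a4,
      0 < sigma ->
        [/\ is_ellipse (X4_locus a b Ec) C4 'i a4 b4,
            homothetic (rotate90 (outer_ellipse a b)) (X4_locus a b Ec) &
            a4 / b4 = a / b] &
      sigma = 0 -> X4_locus a b Ec = [set C4]].
Proof.
move=> c2 sigma C4 a4 b4.
have a0 : 0 < a by exact: lt_le_trans hab.
have locus : X4_locus a b Ec = ellipse_curve C4 'i%C a4 b4.
  exact: X4_locus_ellipse hEc hnested hporism hfg.
have s0 : 0 <= sigma by rewrite /sigma modulusE sqrtr_ge0.
have ba : b4 <= a4.
  by rewrite /a4 /b4 ler_wpM2l // lef_pV2 ?posrE ?mulr_gt0 // ler_pM2l.
split=> // [sigma0|sigma0]; rewrite locus.
  split.
  - split=> //; last by rewrite divr_gt0 // mulr_gt0.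
    by rewrite modulusE /dot /= mul0r mulr1 add0r sqrtr1.
  - exact: rotate90_outer_ellipse_homothetic.
  - by rewrite /a4 /b4; field; rewrite !gt_eqF.
rewrite /a4 /b4 sigma0 !mul0r; apply/seteqP; split=> [_ [s [t [_ ->]]]|_ ->] /=.
  by rewrite !mul0r mulr0 addr0.
by exists 1, 0; rewrite !mul0r mulr0 addr0 expr1n expr0n addr0.
Qed.
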